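(* Let $X$ and $Y$ be Banach spaces, and let $\theta_k:X\to Y$ ($k\in\mathbb{N}\cup\{\infty\}$) be linear maps (not assumed to be bounded). For any sequence $\{x_k\}_{k\in\mathbb{N}}$ in $X$, put $\theta(\{x_k\}_{k\in\mathbb{N}}):=\{\theta_k(x_k)\}_{k\in\mathbb{N}}$. (a) If $\theta(c_0(X))\subseteq c_0(Y)$, then there exists $n_0\in\mathbb{N}$ such that $\sup_{n\ge n_0}\|\theta_n\|<\infty$. (b) If $\lim_{k\to\infty}\theta_k(x_k)=\theta_\infty(x)$ for any $\{x_k\}_{k\in\mathbb{N}}\in\ell^\infty(X)$ with $\lim_{k\to\infty}x_k=x$, then $\theta_\infty$ is bounded, and there is $n_0\in\mathbb{N}$ such that $\sup_{n\ge n_0}\|\theta_n\|<\infty$. (c) Suppose that $\theta(\ell^\infty(X))\subseteq\ell^\infty(Y)$, and that $\lim_{\mathcal{F}}\theta_k(x_k)=0$ for every $\{x_k\}_{k\in\mathbb{N}}\in\ell^\infty(X)$ and every ultrafilter $\mathcal{F}$ on $\mathbb{N}$ with $\lim_{\mathcal{F}}x_k=0$. Then there exist $\mathcal{F}_1,\dots,\mathcal{F}_n\in\beta\mathbb{N}$ with $\sup_{\mathcal{F}\ne\mathcal{F}_1,\dots,\mathcal{F}_n}\|\theta_{\mathcal{F}}\|<\infty$, where $\theta_{\mathcal{F}}:\Xi^{\ell^\infty(X)}_{\mathcal{F}}\to\Xi^{\ell^\infty(Y)}_{\mathcal{F}}$ is the map induced by $\theta$. In particular, $\sup_{n\ge n_0}\|\theta_n\|<\infty$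 for some $n_0\in\mathbb{N}$.
   Context: $\ell^\infty(X)$ and $c_0(X)$ denote the Banach spaces (sup norm) of bounded sequences and of norm-null sequences in $X$. $\beta\mathbb{N}$ is the Stone–Čech compactification of $\mathbb{N}$, identified with the set of all ultrafilters on $\mathbb{N}$ (principal ones included). For $\mathcal{F}\in\beta\mathbb{N}$, $\Xi^{\ell^\infty(X)}_{\mathcal{F}}:=\ell^\infty(X)/\{(x_n)\in\ell^\infty(X):\lim_{\mathcal{F}}x_n=0\}$ with the quotient norm (the fibre at $\mathcal{F}$ of $\ell^\infty(X)$ as a module over $\ell^\infty\cong C(\beta\mathbb{N})$), and similarly for $Y$. All limits are in norm; $\|\cdot\|$ of a linear map is its operator norm (possibly $\infty$). *)

(* Defs.v *)
From HB Require Import structures.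
From mathcomp Require Import all_boot all_order all_algebra.
From mathcomp Require Import generic_quotient ring_quotient complex.
From mathcomp Require Import all_classical all_reals all_analysis.

Set Implicit Arguments.
Unset Strict Implicit.
Unset Printing Implicit Defensive.

Import Order.TTheory GRing.Theory Num.Theory.
Import numFieldNormedType.Exports.

Local Open Scope classical_set_scope.
Local Open Scope ring_scope.
Local Open Scope quotient_scope.

Variant scalars := RealScalars | ComplexScalars.

(* The scalar field of the Banach spaces: real or complex numbers. *)
Definition scalar_field (R : realType) (s : scalars) : numFieldType :=
  match s with RealScalars => R | ComplexScalars => complex R end.

(* In MathComp-Analysis the norm of a normed module over K is valued in K; this
   brings it back to R when K is the field of complex numbers. *)
Definition real_part (R : realType) (s : scalars) : scalar_field R s -> R :=
  match s with RealScalars => id | ComplexScalars => @complex.Re R end.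

Definition rnorm (R : realType) (s : scalars)
    (V : normedModType (scalar_field R s)) (v : V) : R :=
  real_part `|v|.

(* The (semi)norms on the domain and codomain are explicit arguments, so that
   the definition applies to Banach spaces and to the fibres Xi below. *)
Definition opnorm (R : realType) (V W : Type) (nV : V -> R) (nW : W -> R)
    (f : V -> W) : \bar R :=
  ereal_sup [set (nW (f v))%:E | v in [set v | nV v <= 1]].

Definition banach_opnorm (R : realType) (s : scalars)
    (V W : normedModType (scalar_field R s)) (f : V -> W) : \bar R :=
  opnorm (@rnorm R s V) (@rnorm R s W) f.

Record betaN := BetaN {
  betaN_sets : set_system nat;
  betaN_ultra :: UltraFilter betaN_sets }.

Section SequenceSpaces.
Variables (K : numFieldType) (V : normedModType K).

Definition c0_seq : set (nat -> V) := [set x | x @ \oo --> (0 : V)].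

Definition linf_seq : set (nat -> V) := bounded_fun.

Definition linf_pred : {pred nat -> V} := fun x => `[< linf_seq x >].

Lemma linf_submod_closed : submod_closed linf_pred.
Proof.
split=> [|a x y /asboolP bx /asboolP b_y]; apply/asboolP.
  exists 0; split=> // M M0 n _ /=.
  have -> : (0 : nat -> V) n = 0 by [].
  by rewrite normr0 ltW.
move: bx b_y => [M [Mr Mx]] [N [Nr Ny]].
have M1 n : `|x n| <= `|M| + 1.
  apply: (Mx (`|M| + 1)) => //.
  by rewrite (le_lt_trans (real_ler_norm Mr))// ltrDl.
have N1 n : `|y n| <= `|N| + 1.
  apply: (Ny (`|N| + 1)) => //.
  by rewrite (le_lt_trans (real_ler_norm Nr))// ltrDl.
exists (`|a| * (`|M| + 1) + (`|N| + 1)); split.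
  by rewrite realD ?realM ?realD ?normr_real.
move=> B hB n _; apply: le_trans (ltW hB).
have -> : (a *: x + y) n = a *: x n + y n by [].
rewrite (le_trans (ler_normD _ _))// lerD//.
by rewrite normrZ ler_wpM2l.
Qed.

HB.instance Definition _ :=
  GRing.isSubmodClosed.Build K (nat -> V) linf_pred linf_submod_closed.

Record linf := Linf { linf_val :> nat -> V; linf_valP : linf_val \in linf_pred }.

HB.instance Definition _ := [isSub for linf_val].
HB.instance Definition _ := [Choice of linf by <:].
HB.instance Definition _ := [SubChoice_isSubLmodule of linf by <:].

Definition null_pred (F : betaN) : {pred linf} :=
  fun x => `[< linf_val x @ betaN_sets F --> (0 : V) >].

Lemma null_submod_closed F : submod_closed (null_pred F).
Proof.
split=> [|a x y /asboolP x0 /asboolP y0]; apply/asboolP.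
  have -> : linf_val (0 : linf) = cst 0 by [].
  exact: cvg_cst.
have -> : linf_val (a *: x + y) = (fun n => a *: x n + y n) by [].
rewrite -[X in _ --> X]addr0 -[X in _ --> X + _](scaler0 _ a).
by apply: cvgD => //; apply: cvgZr.
Qed.

HB.instance Definition _ F :=
  GRing.isSubmodClosed.Build K linf (null_pred F) (null_submod_closed F).

Definition Xi (F : betaN) : Type := Quotient.quot (null_pred F).

End SequenceSpaces.

Arguments c0_seq {K} V.
Arguments linf_seq {K} V.
Arguments linf_pred {K} V.
Arguments null_pred {K} V F.

Definition linf_norm (R : realType) (s : scalars)
    (V : normedModType (scalar_field R s)) (x : linf V) : R :=
  sup [set rnorm (x n) | n in [set: nat]].

Definition Xi_norm (R : realType) (s : scalars)
    (V : normedModType (scalar_field R s)) (F : betaN) (q : Xi V F) : R :=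
  inf [set linf_norm x | x in [set x : linf V | \pi_(Xi V F) x = q]].

Section InducedMaps.
Variables (K : numFieldType) (X Y : normedModType K).
Variable theta : nat -> {linear X -> Y}.

Definition theta_seq (x : nat -> X) : nat -> Y := fun k => theta k (x k).

Hypothesis theta_linf : theta_seq @` linf_seq X `<=` linf_seq Y.

Lemma linf_map_subproof (x : linf X) : theta_seq x \in linf_pred Y.
Proof.
apply/asboolP/theta_linf; exists (linf_val x) => //.
by apply/asboolP; exact: linf_valP.
Qed.

Definition linf_map (x : linf X) : linf Y := Linf (linf_map_subproof x).

(* Defined through a representative; [Xi_map_pi] shows independence. *)
Definition Xi_map (F : betaN) (q : Xi X F) : Xi Y F :=
  \pi_(Xi Y F) (linf_map (repr q)).

Lemma Xi_map_pi (F : betaN) (x : linf X) :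
  (forall z : linf X, z \in null_pred X F -> linf_map z \in null_pred Y F) ->
  Xi_map (\pi_(Xi X F) x) = \pi_(Xi Y F) (linf_map x).
Proof.
move=> theta_null; apply/eqP; rewrite /Xi_map -Quotient.idealrBE.
have -> : linf_map (repr (\pi_(Xi X F) x)) - linf_map x =
    linf_map (repr (\pi_(Xi X F) x) - x).
  by apply/val_inj/funext => n /=; rewrite /theta_seq/= linearB.
by apply: theta_null; rewrite Quotient.idealrBE reprK.
Qed.

End InducedMaps.

(* Main.v *)
(* A gliding hump gives (a): if the norms were unbounded on every tail, unit
   vectors v_k with |theta_(n_k) v_k| > k+1 would make v_k / (k+1), placed at
   n_k, a null sequence whose image is not null.  In (c), theta maps null
   sequences to null sequences, because a sequence is null as soon as it is null
   along every free ultrafilter; so (a) bounds theta_n for n >= n0.  The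
   exceptional ultrafilters can then be taken to be the principal ones at
   i < n0, since every other ultrafilter contains {n | n0 <= n}. *)
Require Import Defs.
From mathcomp Require Import all_boot all_order all_algebra.
From mathcomp Require Import generic_quotient ring_quotient complex.
From mathcomp Require Import all_classical all_reals all_analysis.

Set Implicit Arguments.
Unset Strict Implicit.
Unset Printing Implicit Defensive.

Import Order.TTheory GRing.Theory Num.Theory.
Import numFieldNormedType.Exports.

Local Open Scope classical_set_scope.
Local Open Scope ring_scope.

(** * Real-valued norms over both scalar fields *)

Section RealNorm.
Variables (R : realType) (s : scalars).
Implicit Type V W : normedModType (scalar_field R s).

(** Complex numbers are comparable only when their imaginary parts agree, and nonnegative ones have
    imaginary part 0, so their order is that of the real parts. *)
Lemma real_part_bounds (z a : scalar_field R s) : 0 <= z -> 0 <= a ->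
  ((z <= a) = (real_part z <= real_part a)) *
  ((z < a) = (real_part z < real_part a)).
Proof.
case: s z a => //= z a; rewrite !lecE ltcE/= => /andP[/eqP -> _] /andP[/eqP -> _].
by rewrite eqxx.
Qed.

Lemma real_part_nonneg_lift (e : R) : 0 <= e ->
  exists2 z : scalar_field R s, 0 <= z & real_part z = e.
Proof.
case: s => /= e0; first by exists e.
by exists (real_complex R e) => //; rewrite lecR.
Qed.

Lemma real_partM (a b : scalar_field R s) : 0 <= a -> 0 <= b ->
  real_part (a * b) = real_part a * real_part b.
Proof.
case: s a b => //= a b; rewrite !lecE /= => /andP[/eqP a0 _] /andP[/eqP b0 _].
by case: a b a0 b0 => [a a'] [b b'] /= -> ->; rewrite mulr0 subr0.
Qed.

Lemma real_part_nat (n : nat) : real_part (n%:R : scalar_field R s) = n%:R.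
Proof. by case: s => //=; rewrite raddfMn. Qed.

Lemma real_part_ge0 (a : scalar_field R s) : 0 <= a -> 0 <= real_part a.
Proof. by case: s a => //= a; rewrite lecE => /andP[]. Qed.

Lemma rnorm_ge0 V (v : V) : 0 <= rnorm v.
Proof. exact/real_part_ge0/normr_ge0. Qed.

Lemma rnorm0 V : rnorm (0 : V) = 0.
Proof. by rewrite /rnorm normr0 (real_part_nat 0). Qed.

Lemma rnormD V (v w : V) : rnorm (v + w) <= rnorm v + rnorm w.
Proof.
have real_partD (a b : scalar_field R s) :
  real_part (a + b) = real_part a + real_part b by case: s a b => //= -[? ?] [].
by rewrite /rnorm -real_partD -real_part_bounds// ?addr_ge0// ler_normD.
Qed.

Lemma rnorm_scale_nat V (n : nat) (v : V) : rnorm (n%:R *: v) = n%:R * rnorm v.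
Proof. by rewrite /rnorm normrZ real_partM// normr_nat real_part_nat. Qed.

Lemma rnorm_scale_invnat V (n : nat) (v : V) :
  rnorm ((n.+1%:R)^-1 *: v) = n.+1%:R^-1 * rnorm v.
Proof.
have {2}-> : v = n.+1%:R *: (n.+1%:R^-1 *: v).
  by rewrite scalerA divff ?pnatr_eq0// scale1r.
by rewrite rnorm_scale_nat mulrA mulVf ?pnatr_eq0// mul1r.
Qed.

Lemma cvg0_rnorm V (T : Type) (F : set_system T) (FF : Filter F) (x : T -> V) :
  x @ F --> (0 : V) <-> forall e : R, 0 < e -> \forall t \near F, rnorm (x t) < e.
Proof.
split=> [/cvgr0Pnorm_lt x0 e e0|x0].
  have [z z0 ze] := @real_part_nonneg_lift e (ltW e0).
  have z_gt0 : 0 < z by rewrite (real_part_bounds _ z0)// (real_part_nat 0) ze.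
  near=> t; rewrite /rnorm -ze -(real_part_bounds (normr_ge0 _) z0).
  by near: t; exact: x0.
apply/cvgr0Pnorm_lt => e e0.
have re : 0 < real_part e.
  by move: (e0); rewrite (real_part_bounds _ (ltW e0))// (real_part_nat 0).
near=> t; rewrite (real_part_bounds (normr_ge0 _) (ltW e0)).
by near: t; exact: x0.
Unshelve. all: by end_near. Qed.

Lemma linf_seqP V (x : nat -> V) :
  linf_seq V x <-> exists M : R, forall n, rnorm (x n) <= M.
Proof.
split=> [[M [Mr Mx]]|[M Mx]].
  (* [bounded_fun] speaks only of bounds strictly above [M]; [|M| + 1] is one, and it is
     nonnegative, as the passage to real parts requires. *)
  have M1 n : `|x n| <= `|M| + 1.
    apply: (Mx (`|M| + 1)) => //.
    by rewrite (le_lt_trans (real_ler_norm Mr))// ltrDl.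
  exists (real_part (`|M| + 1)) => n.
  by rewrite -(real_part_bounds (normr_ge0 _))// addr_ge0.
have [z z0 zM] := real_part_nonneg_lift (le_trans (rnorm_ge0 _) (Mx 0%N)).
exists z; split=> [|B zB n _ /=]; first exact: ger0_real.
by apply: le_trans (ltW zB); rewrite real_part_bounds// zM; exact: Mx.
Qed.

Lemma banach_opnorm_le V W (f : V -> W) (C : R) :
  (forall v, rnorm v <= 1 -> rnorm (f v) <= C) -> (banach_opnorm f <= C%:E)%E.
Proof.
move=> fC; apply: ge_ereal_sup => _ [v /= v1 <-].
by rewrite lee_fin; exact: fC.
Qed.

(** A single real constant, which the supremum over the tail, the pointwise limit and the fibres can
    all reuse. *)
Definition tail_bounded V W (f : nat -> V -> W) (n0 : nat) (C : R) :=
  forall n, (n0 <= n)%N -> forall v, rnorm v <= 1 -> rnorm (f n v) <= C.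

Lemma tail_bounded_sup V W (f : nat -> V -> W) n0 C : tail_bounded f n0 C ->
  (ereal_sup [set banach_opnorm (f n) | n in [set n | (n0 <= n)%N]] < +oo)%E.
Proof.
move=> fC; apply: (@le_lt_trans _ _ C%:E); last exact: ltry.
by apply: ge_ereal_sup => _ [n /= n0n <-]; exact/banach_opnorm_le/fC.
Qed.

End RealNorm.

(** * Gliding hump for maps preserving null sequences *)

Section GlidingHump.
Variables (R : realType) (s : scalars) (X Y : normedModType (scalar_field R s)).
Variable theta : nat -> {linear X -> Y}.

(** Taking [n0] as threshold and bound at once makes the negation yield, for each [N], an index at
    least [N] and a vector of the unit ball whose image exceeds [N] in norm. *)
Lemma c0_tail_bounded : theta_seq theta @` c0_seq X `<=` c0_seq Y ->
  exists n0 : nat, tail_bounded (fun n => theta n) n0 (n0%:R : R).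
Proof.
move=> theta_c0; apply: contrapT => unbounded.
have /choice[f fP] (N : nat) : exists p : nat * X,
    [/\ (N <= p.1)%N, rnorm p.2 <= 1 & N%:R < rnorm (theta p.1 p.2)].
  apply: contrapT => noN; apply: unbounded; exists N => n Nn v v1.
  by rewrite leNgt; apply/negP => thv; apply: noN; exists (n, v).
(* Each choice is made beyond the previous index, so the indices increase strictly; starting from
   [f 1] gives [k < (h k).1] and the bound [k.+1] in [h_large]. *)
pose h := fix h k := if k is k'.+1 then f (h k').1.+1 else f 1%N.
have h_lt k : ((h k).1 < (h k.+1).1)%N by have [] := fP (h k).1.+1.
have h_mono : {homo (fun k => (h k).1) : k l / (k < l)%N}.
  exact: homo_ltn ltn_trans h_lt.
have h_le1 k : rnorm (h k).2 <= 1.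
  by case: k => [|k]; [have [] := fP 1%N | have [] := fP (h k).1.+1].
have k_lt k : (k < (h k).1)%N.
  by elim: k => [|k /leq_ltn_trans]; [have [] := fP 1%N | apply].
have h_large k : k.+1%:R < rnorm (theta (h k).1 (h k).2).
  case: k => [|k] /=; first by have [] := fP 1%N.
  have [_ _] := fP (h k).1.+1; apply: le_lt_trans.
  by rewrite ler_nat ltnS k_lt.
(* The number of the hump at a position is picked by choice; it is unique because the indices
   increase strictly. *)
pose x n := if pselect (exists k, (h k).1 = n) is left e
            then (projT1 (cid e)).+1%:R^-1 *: (h (projT1 (cid e))).2 else 0.
have xh k : x (h k).1 = k.+1%:R^-1 *: (h k).2.
  rewrite /x; case: pselect => [e|]; last by case; exists k.
  case: cid => /= l lk; suff -> : l = k by [].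
  by case: (ltngtP l k) => // /h_mono; rewrite lk ltnn.
have x0 : c0_seq X x.
  apply/cvg0_rnorm => e e0; have [K] := ltr_add_invr e0; rewrite add0r => Ke.
  exists (h K).1 => //= n /= hKn.
  have [[k kn]|nok] := pselect (exists k, (h k).1 = n); last first.
    by rewrite /x; case: pselect => // _; rewrite rnorm0.
  rewrite -kn in hKn *; rewrite xh rnorm_scale_invnat.
  apply: le_lt_trans Ke; rewrite -[leRHS]mulr1 ler_pM ?rnorm_ge0//.
  (* If [n = (h k).1] is at least [(h K).1], then [K <= k] by monotonicity. *)
  rewrite lef_pV2 ?posrE// ler_nat ltnS leqNgt.
  by apply: contraL hKn => /h_mono; rewrite -ltnNge.
(* With tolerance 1, the hump at [(h N).1], an index beyond [N], has an image of norm greater than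
   1. *)
have /cvg0_rnorm /(_ 1 ltr01)[N _ /(_ (h N).1 (ltnW (k_lt N)))/=] :=
    theta_c0 _ (ex_intro2 _ _ x x0 erefl).
rewrite /theta_seq xh linearZ /= rnorm_scale_invnat ltNge => /negP; apply.
by rewrite mulrC ler_pdivlMr// mul1r; exact: ltW.
Qed.

End GlidingHump.

(** * Ultrafilters and tails of the natural numbers *)

Section Ultrafilters.

#[local] Existing Instance betaN_ultra.

Lemma betaN_eq (F G : betaN) : betaN_sets F = betaN_sets G -> F = G.
Proof. by case: F G => [F FU] [G GU] /= FG; case: _ / FG GU => GU; congr BetaN. Qed.

Definition principal_betaN (n : nat) : betaN := BetaN (principal_filter_ultra n).

Lemma betaN_principal (F : betaN) (n : nat) :
  betaN_sets F [set n] -> F = principal_betaN n.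
Proof.
move=> Fn; apply/betaN_eq/seteqP; split=> A /=.
  move=> FA; apply/principal_filterP.
  by have [k [-> ]] := filter_ex (filterI Fn FA).
by move=> /principal_filterP An; apply: filterS Fn => k ->.
Qed.

(** An ultrafilter contains [[set n]] or its complement, and only the principal one at [n] contains
    [[set n]]; the points below the threshold are thus removed one at a time. *)
Lemma betaN_tail (F : betaN) (n : nat) :
  (forall i : 'I_n, F <> principal_betaN i) ->
  betaN_sets F [set k | (n <= k)%N].
Proof.
elim: n => [|n IHn] F_ne; first exact: filterS filterT.
have Fn : betaN_sets F [set k | (n <= k)%N].
  by apply: IHn => i; exact: (F_ne (widen_ord (leqnSn n) i)).
have [/betaN_principal Fn1|FnC] := in_ultra_setVsetC [set n] (betaN_ultra F).
  by have := F_ne ord_max.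
apply: filterS (filterI Fn FnC) => k [/= nk kn].
by rewrite ltn_neqAle nk andbT; apply/eqP => nk1; exact: kn.
Qed.

(* If [P] failed frequently, an ultrafilter refining the trace of the Frechet
   filter on the complement of [P] would not contain [P]. *)
Lemma eventually_betaN (P : set nat) :
  (forall F : betaN, \oo `<=` betaN_sets F -> betaN_sets F P) ->
  \forall n \near \oo, P n.
Proof.
move=> FP; apply: contrapT => nP.
have proper : ProperFilter (within (~` P) \oo).
  apply: Build_ProperFilter.
  rewrite /within /mkset => nP0; apply: nP; apply: filterS nP0 => n.
  exact: contrapT.
have [G [GU PG]] := ultraFilterLemma proper.
have GP : G P.
  apply: (FP (BetaN GU)) => A ooA /=; apply: PG.
  by apply: filterS ooA => n An _.
have GnP : G (~` P) by apply: PG; exact: withinT.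
by have [n []] := filter_ex (filterI GP GnP).
Qed.

End Ultrafilters.

(** * Quotient norms and induced maps on the fibres *)

Section Fibres.
Variables (R : realType) (s : scalars) (X Y : normedModType (scalar_field R s)).
Variable theta : nat -> {linear X -> Y}.

#[local] Existing Instance betaN_ultra.

Lemma fibre_null_c0 :
  (forall x : nat -> X, linf_seq X x -> forall F : betaN,
    x @ betaN_sets F --> (0 : X) ->
    theta_seq theta x @ betaN_sets F --> (0 : Y)) ->
  theta_seq theta @` c0_seq X `<=` c0_seq Y.
Proof.
move=> theta_null _ [x x0 <-]; apply/cvg0_rnorm => e e0.
apply: eventually_betaN => F ooF.
have /cvg0_rnorm thx0 : theta_seq theta x @ betaN_sets F --> (0 : Y).
  apply: theta_null; first exact: cvg_seq_bounded (cvgP _ x0).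
  by apply: cvg_trans x0; exact: (cvg_app x ooF).
exact: thx0.
Qed.

Lemma linf_norm_le (V : normedModType (scalar_field R s)) (x : linf V) (C : R) :
  (forall n, rnorm (x n) <= C) -> linf_norm x <= C.
Proof.
move=> xC; apply: ge_sup; first by exists (rnorm (x 0%N)), 0%N.
by move=> _ [n _ <-].
Qed.

Lemma rnorm_le_linf_norm (V : normedModType (scalar_field R s)) (x : linf V) n :
  rnorm (x n) <= linf_norm x.
Proof.
have /asboolP/linf_seqP[M xM] := linf_valP x.
by apply: ub_le_sup; [exists M => _ [k _ <-] | exists n].
Qed.

Lemma Xi_norm_pi_le (V : normedModType (scalar_field R s)) (F : betaN)
  (x : linf V) : Xi_norm (\pi_(Xi V F)%qT x) <= linf_norm x.
Proof.
apply: ge_inf; last by exists x.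
exists 0 => _ [y _ <-].
exact: le_trans (rnorm_ge0 _) (rnorm_le_linf_norm y 0%N).
Qed.

Lemma Xi_norm_lt (V : normedModType (scalar_field R s)) (F : betaN)
    (q : Xi V F) (C : R) : Xi_norm q < C ->
  exists2 x : linf V, \pi_(Xi V F)%qT x = q & linf_norm x < C.
Proof.
move=> /inf_lt[|_ [x xq <-] xC]; last by exists x.
by exists (linf_norm (repr q)), (repr q) => //=; exact: reprK.
Qed.

Variable theta_linf : theta_seq theta @` linf_seq X `<=` linf_seq Y.

(* A class in the fibre at [F] does not change when a representative is set to
   zero off a set of [F], so only the maps [theta n] with [n0 <= n] count. *)
Lemma fibre_opnorm_le (F : betaN) (n0 : nat) (C : R) :
  (forall x : linf X, x \in null_pred X F ->
    linf_map theta_linf x \in null_pred Y F) ->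
  betaN_sets F [set n | (n0 <= n)%N] ->
  tail_bounded (fun n => theta n) n0 C ->
  (opnorm (@Xi_norm R s X F) (@Xi_norm R s Y F) (Xi_map theta_linf (F := F))
    <= (2 * C)%:E)%E.
Proof.
move=> theta_null Fn0 thC; apply: ge_ereal_sup => _ [q /= q1 <-].
rewrite lee_fin.
(* The quotient norm is an infimum: a class in the unit ball has a representative of norm below 2,
   whence the factor 2. *)
have [|x xq x2] := @Xi_norm_lt X F q 2; first by rewrite (le_lt_trans q1)// ltr1n.
pose y n := if (n0 <= n)%N then x n else 0.
have y2 n : rnorm (y n) <= 2.
  rewrite /y; case: ifP => _; last by rewrite rnorm0.
  by rewrite ltW// (le_lt_trans (rnorm_le_linf_norm _ _)).
have y_linf : y \in linf_pred X by apply/asboolP/linf_seqP; exists 2.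
pose z : linf X := Linf y_linf.
have -> : q = \pi_(Xi X F)%qT z.
  rewrite -xq; apply/eqP; rewrite -Quotient.idealrBE; apply/asboolP.
  apply/cvg0_rnorm => e e0; apply: filterS Fn0 => n /= n0n.
  by rewrite -[X in rnorm X]/(x n - y n) /y n0n subrr rnorm0.
rewrite Xi_map_pi//; apply: le_trans (Xi_norm_pi_le _ _) _.
apply: linf_norm_le => n /=; rewrite /theta_seq /=.
(* At positions below [n0] the image is 0, and the bound [2 * C] there requires [C] nonnegative. *)
have C0 : 0 <= C.
  apply: le_trans (rnorm_ge0 (theta n0 0)) _.
  by apply: thC => //; rewrite rnorm0.
have [n0n|nn0] := leqP n0 n; last first.
  by rewrite /y leqNgt nn0 /= linear0 rnorm0 mulr_ge0.
rewrite -ler_pdivrMl// -rnorm_scale_invnat -linearZ; apply: thC => //.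
by rewrite rnorm_scale_invnat ler_pdivrMl// mulr1.
Qed.

End Fibres.

(** On the unit ball each [g v] lies within 1 of some [f n v] with [n0 <= n]; the index depends on
    [v], the bound [1 + C] does not. *)
Lemma pointwise_limit_bounded (R : realType) (s : scalars)
    (X Y : normedModType (scalar_field R s)) (f : nat -> X -> Y) (g : X -> Y)
    (n0 : nat) (C : R) :
  (forall v, f n v @[n --> \oo] --> g v) -> tail_bounded f n0 C ->
  (banach_opnorm g < +oo)%E.
Proof.
move=> fg fC; apply: (@le_lt_trans _ _ (1 + C)%:E); last exact: ltry.
apply: banach_opnorm_le => v v1.
have /cvg0_rnorm/(_ 1 ltr01) fgv : (fun n => g v - f n v) @ \oo --> (0 : Y).
  by rewrite -(subrr (g v)); apply: cvgB; [exact: cvg_cst | exact: fg].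
have [n [gf1 n0n]] := filter_ex (filterI fgv (nbhs_infty_ge n0)).
rewrite -(subrK (f n v) (g v)); apply: le_trans (rnormD _ _) _.
by apply: lerD; [exact: ltW | exact: fC].
Qed.

Theorem proposition4p7 (R : realType) (s : scalars)
    (X Y : completeNormedModType (scalar_field R s))
    (theta : nat -> {linear X -> Y}) (theta_oo : {linear X -> Y}) :
  (* (a) *)
  (theta_seq theta @` c0_seq X `<=` c0_seq Y ->
    exists n0 : nat,
      (ereal_sup [set banach_opnorm (theta n) | n in [set n | (n0 <= n)%N]]
         < +oo)%E) /\
  (* (b) *)
  ((forall (x : nat -> X) (l : X), linf_seq X x -> x @ \oo --> l ->
      theta_seq theta x @ \oo --> theta_oo l) ->
    (banach_opnorm theta_oo < +oo)%E /\
    exists n0 : nat,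
      (ereal_sup [set banach_opnorm (theta n) | n in [set n | (n0 <= n)%N]]
         < +oo)%E) /\
  (* (c) *)
  (forall theta_linf : theta_seq theta @` linf_seq X `<=` linf_seq Y,
    (forall x : nat -> X, linf_seq X x -> forall F : betaN,
      x @ betaN_sets F --> (0 : X) ->
      theta_seq theta x @ betaN_sets F --> (0 : Y)) ->
    (exists (n : nat) (Fs : 'I_n -> betaN),
      (ereal_sup
         [set opnorm (@Xi_norm R s X F) (@Xi_norm R s Y F)
                (Xi_map theta_linf (F := F))
         | F in [set F : betaN | forall i : 'I_n, F <> Fs i]] < +oo)%E) /\
    exists n0 : nat,
      (ereal_sup [set banach_opnorm (theta n) | n in [set n | (n0 <= n)%N]]
         < +oo)%E).
Proof.
have part_a : theta_seq theta @` c0_seq X `<=` c0_seq Y -> exists n0 : nat,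
    (ereal_sup [set banach_opnorm (theta n) | n in [set n | (n0 <= n)%N]]
      < +oo)%E.
  by move=> /c0_tail_bounded[n0 bnd]; exists n0; exact: tail_bounded_sup bnd.
split=> [//|]; split=> [theta_lim|theta_linf theta_null].
  (* By linearity [theta_oo 0 = 0], so the hypothesis of (b) at limit 0 gives that of (a). *)
  have c0 : theta_seq theta @` c0_seq X `<=` c0_seq Y.
    move=> _ [x x0 <-]; rewrite /c0_seq /= -(linear0 theta_oo).
    by apply: theta_lim (x0); exact: cvg_seq_bounded (cvgP _ x0).
  split; last exact: part_a.
  have [n0] := c0_tail_bounded c0; apply: pointwise_limit_bounded => v.
  (* Constant sequences turn the hypothesis of (b) into pointwise convergence. *)
  apply: (theta_lim (cst v)); last exact: cvg_cst.
  by apply/linf_seqP; exists (rnorm v).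
have c0 := fibre_null_c0 theta_null.
split; last exact: part_a.
have [n0 bnd] := c0_tail_bounded c0.
exists n0, (fun i => principal_betaN i).
apply: (@le_lt_trans _ _ (2 * n0%:R)%:E); last exact: ltry.
apply: ge_ereal_sup => _ [F /= /betaN_tail Fn0 <-].
apply: (fibre_opnorm_le _ Fn0) => // x /asboolP x0; apply/asboolP.
by apply: theta_null => //; apply/asboolP; exact: linf_valP.
Qed.
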